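(* Let $\{\Lambda_t\}_{t\ge0}$ be a dynamical map on $M_d(\mathbb{C})$ with every $\Lambda_t$ invertible, and set $V_{t,s}:=\Lambda_t\Lambda_s^{-1}$ for $t\ge s\ge0$. The following are equivalent: (1) $\{\Lambda_t\}$ is divisible, i.e. $V_{t,s}$ is completely positive for all $t\ge s\ge0$; (2) $\|V_{t,s}\|_\diamond=1$ for all $t\ge s\ge 0$; (3) for every Hermitian $W\in M_d(\mathbb{C})\otimes M_d(\mathbb{C})$, the function $t\mapsto\|(\mathrm{id}\otimes\Lambda_t)W\|_1$ is nonincreasing on $[0,\infty)$.
   Context: A dynamical map is a family $\{\Lambda_t\}_{t\ge0}$ of completely positive trace-preserving linear maps on $M_d(\mathbb{C})$ with $\Lambda_0=\mathrm{id}$. $\|\cdot\|_1$ is the trace norm. For a linear map $\Lambda$ on $M_d(\mathbb{C})$, the diamond norm is $\|\Lambda\|_\diamond:=\sup\{\|(\mathrm{id}\otimes\Lambda)W\|_1: W\in M_d(\mathbb{C})\otimes M_d(\mathbb{C}),\ \|W\|_1=1\}$, where $\mathrm{id}$ is the identity map on $M_d(\mathbb{C})$. *)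

(* Defs.v *)
From Stdlib Require Import Reals.
From HB Require Import structures.
From mathcomp Require Import all_boot all_order all_algebra.
Set Implicit Arguments. Unset Strict Implicit. Unset Printing Implicit Defensive.
Import Order.TTheory GRing.Theory Num.Theory.
Local Open Scope ring_scope.

Section Defs.
Variable C : numClosedFieldType.

Definition adjmx m n (A : 'M[C]_(m, n)) : 'M[C]_(n, m) := (map_mx Num.conj A)^T.

Definition psd n (A : 'M[C]_n) : Prop :=
  forall x : 'cV[C]_n, 0 <= (adjmx x *m A *m x) 0 0.

Definition is_hermitian n (A : 'M[C]_n) : Prop := adjmx A = A.

(* eigenvalues with multiplicity (C algebraically closed) *)
Definition eigenvalues n (A : 'M[C]_n) : seq C :=
  sval (closed_field_poly_normal (char_poly A)).

(* trace norm: sum of singular values = sum of sqrt of eigenvalues of A^* A *)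
Definition trnorm n (A : 'M[C]_n) : C :=
  \sum_(z <- eigenvalues (adjmx A *m A)) sqrtC z.

(* bipartite indices: 'I_(n*m) ~ 'I_n * 'I_m, consistent with mxvec_index *)
Definition idx_pair n m (p : 'I_(n * m)) : 'I_n * 'I_m :=
  enum_val (cast_ord (esym (mxvec_cast n m)) p).

Definition blockmx n m (X : 'M[C]_(n * m)) (i j : 'I_n) : 'M[C]_m :=
  \matrix_(k, l) X (mxvec_index i k) (mxvec_index j l).

(* (id_n (x) f) X *)
Definition ampl n m (f : 'M[C]_m -> 'M[C]_m) (X : 'M[C]_(n * m)) : 'M[C]_(n * m) :=
  \matrix_(p, q) f (blockmx X (idx_pair p).1 (idx_pair q).1) (idx_pair p).2 (idx_pair q).2.

Definition positive_map m (f : 'M[C]_m -> 'M[C]_m) : Prop :=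
  forall X : 'M[C]_m, psd X -> psd (f X).

Definition completely_positive m (f : 'M[C]_m -> 'M[C]_m) : Prop :=
  forall n (X : 'M[C]_(n * m)), psd X -> psd (ampl f X).

Definition trace_preserving m (f : 'M[C]_m -> 'M[C]_m) : Prop :=
  forall X : 'M[C]_m, \tr (f X) = \tr X.

Definition cptp m (f : 'M[C]_m -> 'M[C]_m) : Prop :=
  linear f /\ completely_positive f /\ trace_preserving f.

Definition dynamical_map d (L : R -> 'M[C]_d -> 'M[C]_d) : Prop :=
  (forall t : R, Rle 0 t -> cptp (L t)) /\ (forall X, L R0 X = X).

Definition diamond_norm_is d (f : 'M[C]_d -> 'M[C]_d) (r : C) : Prop :=
  (forall W : 'M[C]_(d * d), trnorm W = 1 -> trnorm (ampl f W) <= r) /\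
  (forall r' : C, (forall W : 'M[C]_(d * d), trnorm W = 1 -> trnorm (ampl f W) <= r') ->
     r <= r').

End Defs.

(* Main.v *)
Require Import Defs.
From Stdlib Require Import Reals.
From HB Require Import structures.
From mathcomp Require Import all_boot all_order all_algebra.
Import Order.TTheory GRing.Theory Num.Theory.
Local Open Scope ring_scope.

Set Implicit Arguments.
Unset Strict Implicit.
Unset Printing Implicit Defensive.

(** Let A = U P be a polar decomposition, so that the trace norm of A is tr P.

    If trnorm A <= tr A, then tr ((U - 1) P (U - 1)^* ) <= 0, hence A = P is positive. So a
    trace-preserving map f such that 1 (x) f does not increase the trace norm of the
    maximally entangled state has a positive Choi matrix, and is completely positive by
    Choi's theorem. The diamond norm gives this bound at once; monotonicity gives it when
    applied to the preimage of the maximally entangled state under 1 (x) L_s, which is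
    Hermitian because L_s commutes with the adjoint.

    Conversely, 2 trnorm W is the least value of tr P1 + tr P2 over the positive block
    matrices [[P1, W], [W^*, P2]]. A Kraus map sends such a block matrix to one for the
    image of W, so it contracts the trace norm if it preserves the trace. *)

Lemma char_poly_conj (R : comNzRingType) n (P Q A : 'M[R]_n) :
  P *m Q = 1%:M -> char_poly (P *m A *m Q) = char_poly A.
Proof.
move=> PQ; rewrite /char_poly /char_poly_mx.
have -> : 'X%:M - map_mx polyC (P *m A *m Q) =
   map_mx polyC P *m ('X%:M - map_mx polyC A) *m map_mx polyC Q.
  rewrite mulmxBr mulmxBl scalar_mxC -[_ *m _ *m map_mx _ Q]mulmxA -!map_mxM PQ.
  by rewrite map_mx1 mulmx1.
by rewrite !det_mulmx mulrAC -det_mulmx -map_mxM PQ map_mx1 det1 mul1r.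
Qed.

Lemma eq_linear_delta (R : pzSemiRingType) (V : lSemiModType R) m n
    (f g : {linear 'M[R]_(m, n) -> V}) :
  (forall i j, f (delta_mx i j) = g (delta_mx i j)) -> f =1 g.
Proof.
move=> fg A; rewrite [A]matrix_sum_delta !linear_sum; apply: eq_bigr => i _.
by rewrite !linear_sum; apply: eq_bigr => j _; rewrite /= !linearZ /= fg.
Qed.

Lemma exists_linear (R : pzRingType) (U V : lmodType R) (f : U -> V) :
  linear f -> exists g : {linear U -> V}, f = g.
Proof.
move=> lin_f.
pose g : {linear U -> V} := HB.pack f (GRing.isLinear.Build R U V _ f lin_f).
by exists g.
Qed.

Lemma sum_block_mx (V : nmodType) m1 m2 n1 n2 (I : Type) (r : seq I) (P : pred I)
    (A : I -> 'M[V]_(m1, n1)) (B : I -> 'M[V]_(m1, n2))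
    (A' : I -> 'M[V]_(m2, n1)) (B' : I -> 'M[V]_(m2, n2)) :
  block_mx (\sum_(i <- r | P i) A i) (\sum_(i <- r | P i) B i)
           (\sum_(i <- r | P i) A' i) (\sum_(i <- r | P i) B' i)
    = \sum_(i <- r | P i) block_mx (A i) (B i) (A' i) (B' i).
Proof.
elim: r => [|i r IHr]; first by rewrite !big_nil block_mx0.
by rewrite !big_cons; case: (P i); rewrite // -IHr add_block_mx.
Qed.

Section Adjoint.
Variable C : numClosedFieldType.

Lemma adjmx_is_linear m n : linear_for (Num.conj \; *:%R) (@adjmx C m n).
Proof. by move=> c A B; apply/matrixP=> i j; rewrite !mxE rmorphD rmorphM. Qed.

HB.instance Definition _ m n :=
  GRing.isLinear.Build C _ _ _ (@adjmx C m n) (@adjmx_is_linear m n).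

Lemma adjmxK m n : cancel (@adjmx C m n) (@adjmx C n m).
Proof. by move=> A; apply/matrixP=> i j; rewrite !mxE conjCK. Qed.

Lemma adjmxM m n p (A : 'M[C]_(m, n)) (B : 'M[C]_(n, p)) :
  adjmx (A *m B) = adjmx B *m adjmx A.
Proof. by rewrite /adjmx map_mxM trmx_mul. Qed.

Lemma adjmx1 n : adjmx (1%:M : 'M[C]_n) = 1%:M.
Proof. by rewrite /adjmx map_mx1 trmx1. Qed.

Lemma adjmx_delta m n (i : 'I_m) (j : 'I_n) :
  adjmx (delta_mx i j : 'M[C]_(m, n)) = delta_mx j i.
Proof. by rewrite /adjmx map_delta_mx trmx_delta. Qed.

Lemma adjmx_row m n1 n2 (A : 'M[C]_(m, n1)) (B : 'M[C]_(m, n2)) :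
  adjmx (row_mx A B) = col_mx (adjmx A) (adjmx B).
Proof. by rewrite /adjmx map_row_mx tr_row_mx. Qed.

Lemma adjmx_col m1 m2 n (A : 'M[C]_(m1, n)) (B : 'M[C]_(m2, n)) :
  adjmx (col_mx A B) = row_mx (adjmx A) (adjmx B).
Proof. by rewrite /adjmx map_col_mx tr_col_mx. Qed.

Lemma adjmx_block m1 m2 n1 n2 (A : 'M[C]_(m1, n1)) (B : 'M[C]_(m1, n2))
    (A' : 'M[C]_(m2, n1)) (B' : 'M[C]_(m2, n2)) :
  adjmx (block_mx A B A' B') = block_mx (adjmx A) (adjmx A') (adjmx B) (adjmx B').
Proof. by rewrite /adjmx map_block_mx tr_block_mx. Qed.

Lemma mxtrace_adj n (A : 'M[C]_n) : \tr (adjmx A) = (\tr A)^*.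
Proof. by rewrite /mxtrace rmorph_sum; apply: eq_bigr => i _; rewrite !mxE. Qed.

Lemma unitarymx_mulmx_adj m n (Q : 'M[C]_(m, n)) :
  Q \is unitarymx -> Q *m adjmx Q = 1%:M.
Proof. by rewrite /adjmx map_trmx => /unitarymxP. Qed.

Lemma sesqform_delta n (A : 'M[C]_n) i j :
  (adjmx (delta_mx i 0 : 'cV_n) *m A *m (delta_mx j 0 : 'cV_n)) 0 0 = A i j.
Proof. by rewrite adjmx_delta -rowE -colE !mxE. Qed.

Lemma quadform_eq0 n (A : 'M[C]_n) :
  (forall x : 'cV_n, (adjmx x *m A *m x) 0 0 = 0) -> A = 0.
Proof.
move=> A0; pose e i : 'cV[C]_n := delta_mx i 0.
have polar c i j : c^* * A i j + c * A j i = 0.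
  have := A0 (c *: e i + e j).
  rewrite [adjmx _]linearP /= mulmxDr !mulmxDl -!scalemxAl -!scalemxAr.
  rewrite -trace_mx11 !linearD !linearZ /= !trace_mx11 !A0 !sesqform_delta.
  by rewrite !mulr0 add0r addr0 addrC.
apply/matrixP=> i j; rewrite [RHS]mxE.
have := polar 1 i j; rewrite conjC1 !mul1r => /eqP; rewrite addr_eq0 => /eqP Aij.
have := polar 'i i j; rewrite conjCi Aij mulrNN -mulr2n => /eqP.
by rewrite mulrn_eq0 mulf_eq0 (negbTE (neq0Ci _)) /= => /eqP->; rewrite oppr0.
Qed.

End Adjoint.

Section PositiveSemidefinite.
Variable C : numClosedFieldType.

Lemma psd_congr m n (A : 'M[C]_n) (X : 'M[C]_(m, n)) :
  psd A -> psd (X *m A *m adjmx X).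
Proof. by move=> pA x; have := pA (adjmx X *m x); rewrite adjmxM adjmxK !mulmxA. Qed.

Lemma psdD n (A B : 'M[C]_n) : psd A -> psd B -> psd (A + B).
Proof. by move=> pA pB x; rewrite mulmxDr mulmxDl mxE addr_ge0 ?pA ?pB. Qed.

Lemma psdZ n (c : C) (A : 'M[C]_n) : 0 <= c -> psd A -> psd (c *: A).
Proof. by move=> c0 pA x; rewrite -scalemxAr -scalemxAl mxE mulr_ge0 //; exact: pA. Qed.

Lemma psd0 n : psd (0 : 'M[C]_n).
Proof. by move=> x; rewrite mulmx0 mul0mx mxE. Qed.

Lemma psd_gram m n (S : 'M[C]_(m, n)) : psd (S *m adjmx S).
Proof.
move=> x; rewrite mulmxA -mulmxA -[adjmx x *m S]adjmxK adjmxM adjmxK mxE.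
by rewrite sumr_ge0 // => i _; rewrite !mxE mulrC mul_conjC_ge0.
Qed.

Lemma psd1 n : psd (1%:M : 'M[C]_n).
Proof. by have := psd_gram (1%:M : 'M[C]_n); rewrite adjmx1 mulmx1. Qed.

Lemma psd_diag_ge0 n (A : 'M[C]_n) i : psd A -> 0 <= A i i.
Proof. by move=> pA; rewrite -sesqform_delta; exact: pA. Qed.

Lemma mxtrace_psd_ge0 n (A : 'M[C]_n) : psd A -> 0 <= \tr A.
Proof. by move=> pA; apply: sumr_ge0 => i _; exact: psd_diag_ge0. Qed.

Lemma psd_ulsubmx m n (A : 'M[C]_(m + n)) : psd A -> psd (ulsubmx A).
Proof.
rewrite -{1}[A]submxK => /(@psd_congr _ _ _ (row_mx 1%:M 0)).
rewrite adjmx_row linear0 adjmx1 mul_row_block mul_row_col.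
by rewrite !mul1mx !mul0mx !mulmx0 mulmx1 !addr0.
Qed.

Lemma psd_hermitian n (A : 'M[C]_n) : psd A -> is_hermitian A.
Proof.
move=> pA; apply/eqP; rewrite -subr_eq0; apply/eqP/quadform_eq0 => x.
have -> : adjmx x *m (adjmx A - A) *m x
    = adjmx (adjmx x *m A *m x) - adjmx x *m A *m x.
  by rewrite mulmxBr mulmxBl !adjmxM adjmxK mulmxA.
by rewrite -trace_mx11 linearB /= mxtrace_adj trace_mx11 (geC0_conj (pA x)) subrr.
Qed.

Lemma psd_mulmx_adj m n (U : 'M[C]_(m, n)) (P : 'M[C]_n) :
  psd P -> P *m adjmx U = adjmx (U *m P).
Proof. by move=> pP; rewrite adjmxM (psd_hermitian pP). Qed.

Definition unitary_diag n (Q : 'M[C]_n) (D : 'rV[C]_n) : 'M[C]_n :=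
  adjmx Q *m diag_mx D *m Q.

Lemma unitary_diagM n (Q : 'M[C]_n) (D E : 'rV[C]_n) : Q \is unitarymx ->
  unitary_diag Q D *m unitary_diag Q E = unitary_diag Q (\row_i (D 0 i * E 0 i)).
Proof.
move=> /unitarymx_mulmx_adj QQ; rewrite /unitary_diag.
by rewrite -!mulmxA (mulmxA Q) QQ mul1mx (mulmxA (diag_mx D)) mulmx_diag.
Qed.

Lemma mxtrace_unitary_diag n (Q : 'M[C]_n) (D : 'rV[C]_n) : Q \is unitarymx ->
  \tr (unitary_diag Q D) = \sum_i D 0 i.
Proof.
by move=> Qu; rewrite mxtrace_mulC mulmxA unitarymx_mulmx_adj // mul1mx mxtrace_diag.
Qed.

Lemma char_poly_unitary_diag n (Q : 'M[C]_n) (D : 'rV[C]_n) : Q \is unitarymx ->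
  char_poly (unitary_diag Q D) = \prod_i ('X - (D 0 i)%:P).
Proof.
move=> /unitarymx_mulmx_adj/mulmx1C QQ; rewrite char_poly_conj //.
rewrite char_poly_trig ?diag_mx_is_trig //.
by apply: eq_bigr => i _; rewrite mxE eqxx.
Qed.

Lemma psd_unitary_diag n (Q : 'M[C]_n) (D : 'rV[C]_n) :
  (forall i, 0 <= D 0 i) -> psd (unitary_diag Q D).
Proof.
move=> D0; rewrite /unitary_diag -[Q in _ *m Q]adjmxK; apply: psd_congr => x.
suff -> : (adjmx x *m diag_mx D *m x) 0 0 = \sum_i `|x i 0| ^+ 2 * D 0 i.
  by rewrite sumr_ge0 // => i _; rewrite mulr_ge0 ?exprn_ge0.
rewrite mul_mx_diag mxE; apply: eq_bigr => i _.
by rewrite !mxE mulrAC normCK [x i 0 * _]mulrC.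
Qed.

Lemma psd_spectral n (A : 'M[C]_n) : psd A ->
  exists2 Q, Q \is unitarymx &
  exists2 D : 'rV[C]_n, forall i, 0 <= D 0 i & A = unitary_diag Q D.
Proof.
move=> pA; exists (spectralmx A); first exact: spectral_unitarymx.
have QQ := unitarymx_mulmx_adj (spectral_unitarymx A).
have AE : A = unitary_diag (spectralmx A) (spectral_diag A).
  rewrite /unitary_diag /adjmx map_trmx -invmx_unitary ?spectral_unitarymx //.
  apply/orthomx_spectralP/normalmxP.
  by rewrite -map_trmx [(map_mx _ _)^T](psd_hermitian pA).
exists (spectral_diag A) => // i.
have := psd_diag_ge0 i (psd_congr (spectralmx A) pA).
by rewrite {2}AE !mulmxA QQ mul1mx -mulmxA QQ mulmx1 mxE eqxx.
Qed.

Lemma psd_sqrt n (A : 'M[C]_n) : psd A -> exists2 P, psd P & A = P *m P.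
Proof.
case/psd_spectral => Q Qu [D D0 ->].
exists (unitary_diag Q (\row_i sqrtC (D 0 i))).
  by apply: psd_unitary_diag => i; rewrite mxE sqrtC_ge0.
rewrite unitary_diagM //; congr unitary_diag.
by apply/rowP=> i; rewrite !mxE -expr2 sqrtCK.
Qed.

(* The eigenvalues of T are the inverses of those of P, where 0^-1 = 0. *)
Lemma psd_pinv n (P : 'M[C]_n) : psd P ->
  exists T, [/\ psd T, T *m P = P *m T, P *m T *m P = P & T *m P *m T = T].
Proof.
case/psd_spectral => Q Qu [D D0 ->].
have mulxVx x : x * x^-1 * x = x :> C.
  by have [->|x0] := eqVneq x 0; rewrite ?mulr0 // mulfV // mul1r.
exists (unitary_diag Q (\row_i (D 0 i)^-1)); split.
  by apply: psd_unitary_diag => i; rewrite mxE invr_ge0.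
all: rewrite !unitary_diagM //; congr unitary_diag; apply/rowP=> i; rewrite !mxE.
- by rewrite mulrC.
- by rewrite mulxVx.
- by rewrite -{2}[D 0 i]invrK mulxVx.
Qed.

Lemma mxtrace_gram_eq0 m n (A : 'M[C]_(m, n)) : \tr (A *m adjmx A) = 0 -> A = 0.
Proof.
have gram_diagE i : (A *m adjmx A) i i = \sum_j `|A i j| ^+ 2.
  by rewrite mxE; apply: eq_bigr => j _; rewrite !mxE normCK.
move/eqP; rewrite psumr_eq0 => [/allP A0|i _]; last exact/psd_diag_ge0/psd_gram.
apply/matrixP=> i j; rewrite [RHS]mxE; apply/eqP; rewrite -normr_eq0 -sqrf_eq0.
have := A0 i (mem_index_enum i); rewrite gram_diagE psumr_eq0 /= => [/allP|k _].
  by apply; exact: mem_index_enum.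
exact: exprn_ge0.
Qed.

Lemma mxtrace_psd_congr_eq0 m n (P : 'M[C]_n) (X : 'M[C]_(m, n)) :
  psd P -> \tr (X *m P *m adjmx X) = 0 -> X *m P = 0.
Proof.
case/psd_sqrt => S pS ->; rewrite mulmxA -mulmxA -{2}(psd_hermitian pS) -adjmxM.
by move/mxtrace_gram_eq0 => ->; rewrite mul0mx.
Qed.

End PositiveSemidefinite.

Section TraceNorm.
Variable C : numClosedFieldType.

Lemma trnorm_sqrt n (A P : 'M[C]_n) :
  psd P -> adjmx A *m A = P *m P -> trnorm A = \tr P.
Proof.
case/psd_spectral => Q Qu [D D0 ->]; rewrite unitary_diagM // => AE.
rewrite mxtrace_unitary_diag // /trnorm /eigenvalues AE.
case: closed_field_poly_normal => r /=; rewrite (monicP (char_poly_monic _)) scale1r.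
rewrite char_poly_unitary_diag // -(big_map _ xpredT (fun z => 'X - z%:P)).
move/prod_XsubC_eq => eigE; rewrite -(perm_big _ eigE) big_map.
by apply: eq_bigr => i _; rewrite mxE -expr2 sqrCK.
Qed.

Lemma trnorm_psd n (A : 'M[C]_n) : psd A -> trnorm A = \tr A.
Proof. by move=> pA; apply: trnorm_sqrt; rewrite ?(psd_hermitian pA). Qed.

Definition partial_isometry m n (U : 'M[C]_(m, n)) : Prop :=
  U *m adjmx U *m U = U.

Lemma partial_isometry_mxtrace_le m n (U : 'M[C]_(m, n)) (N : 'M[C]_m) :
  partial_isometry U -> psd N -> \tr (adjmx U *m N *m U) <= \tr N.
Proof.
move=> UE pN; pose E := 1%:M - U *m adjmx U.
have Eadj : adjmx E = E by rewrite linearB /= adjmx1 adjmxM adjmxK.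
have EE : E *m E = E by rewrite /E mulmxBr mulmx1 mulmxBl mul1mx mulmxA UE subrr subr0.
have := mxtrace_psd_ge0 (psd_congr E pN).
rewrite Eadj mxtrace_mulC mulmxA EE mulmxBl mul1mx linearB /= subr_ge0.
by rewrite [\tr (adjmx U *m _ *m U)]mxtrace_mulC mulmxA.
Qed.

Lemma polar_decomposition n (A : 'M[C]_n) :
  exists U P : 'M[C]_n, [/\ partial_isometry U, psd P, U *m P = A, adjmx U *m A = P
    & trnorm A = \tr P].
Proof.
have [|P pP AE] := @psd_sqrt _ _ (adjmx A *m A).
  by have := psd_gram (adjmx A); rewrite adjmxK.
have [T [pT TP PTP TPT]] := psd_pinv pP.
have TA : adjmx (A *m T) *m A = P.
  by rewrite adjmxM (psd_hermitian pT) -mulmxA AE mulmxA TP.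
have ATP : A *m (T *m P - 1%:M) = 0.
  apply: mxtrace_gram_eq0; rewrite mxtrace_mulC adjmxM mulmxA -(mulmxA _ _ A) AE.
  by rewrite -!mulmxA mulmxBr mulmx1 (mulmxA P T) PTP subrr !mulmx0 linear0.
exists (A *m T), P; split=> //; last exact: trnorm_sqrt.
- by rewrite /partial_isometry -mulmxA (mulmxA _ A) TA -mulmxA (mulmxA T) TPT.
- by apply/eqP; rewrite -subr_eq0 -mulmxA -[X in _ - X]mulmx1 -mulmxBr ATP.
Qed.

Lemma psd_of_trnorm_le_tr n (A : 'M[C]_n) : trnorm A <= \tr A -> psd A.
Proof.
have [U [P [_ pP UP UA ->]]] := polar_decomposition A.
move=> le_tr; suff /eqP : (U - 1%:M) *m P = 0.
  by rewrite mulmxBl mul1mx UP subr_eq0 => /eqP->.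
have trA : \tr (adjmx A) = \tr A.
  by rewrite mxtrace_adj geC0_conj // (le_trans (mxtrace_psd_ge0 pP)).
have trE : \tr ((U - 1%:M) *m P *m adjmx (U - 1%:M)) = (\tr P - \tr A) *+ 2.
  rewrite linearB /= adjmx1 mulmxBr mulmx1 mulmxBl mul1mx UP mulmxBl !linearB /=.
  by rewrite (psd_mulmx_adj _ pP) UP trA mxtrace_mulC UA opprB mulr2n.
apply: mxtrace_psd_congr_eq0 => //; apply/le_anti.
rewrite mxtrace_psd_ge0 ?andbT; last exact: psd_congr.
by rewrite trE pmulrn_lle0 // subr_le0.
Qed.

Lemma exists_block_psd_trnorm n (W : 'M[C]_n) :
  exists P1 P2, [/\ psd (block_mx P1 W (adjmx W) P2), \tr P1 = trnorm W
    & \tr P2 = trnorm W].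
Proof.
have [U [P [_ pP UP UW ->]]] := polar_decomposition W.
exists (W *m adjmx U), P; split=> //; last by rewrite mxtrace_mulC UW.
have := psd_congr (col_mx U 1%:M) pP.
rewrite adjmx_col adjmx1 mul_col_mx mul1mx mul_col_row !mulmx1.
by rewrite (psd_mulmx_adj _ pP) UP.
Qed.

Lemma block_psd_trnorm_le n (W P1 P2 : 'M[C]_n) :
  psd (block_mx P1 W (adjmx W) P2) -> trnorm W *+ 2 <= \tr P1 + \tr P2.
Proof.
have [U [P [isoU pP _ UW ->]]] := polar_decomposition W.
set B := block_mx _ _ _ _ => pB; have WU : \tr (adjmx W *m U) = \tr P.
  by rewrite -[U]adjmxK -adjmxM UW (psd_hermitian pP).
pose X := row_mx (adjmx U) (- 1%:M).
have trE : \tr (X *m B *m adjmx X) = \tr (adjmx U *m P1 *m U) + \tr P2 - \tr P *+ 2.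
  rewrite adjmx_row adjmxK linearN /= adjmx1 mul_row_block mul_row_col.
  rewrite !mulNmx !mul1mx mulmxN mulmx1 mulmxBl UW !linearD !linearN /= WU.
  by rewrite opprK [- _ + _]addrC addrACA -opprD -mulr2n.
have := mxtrace_psd_ge0 (psd_congr X pB); rewrite trE subr_ge0 => /le_trans; apply.
rewrite lerD2r partial_isometry_mxtrace_le //.
by rewrite -(block_mxKul P1 W (adjmx W) P2); exact: psd_ulsubmx.
Qed.

Lemma trnormZ n (c : C) (A : 'M[C]_n) : trnorm (c *: A) = `|c| * trnorm A.
Proof.
have [U [P [_ pP UP UA ->]]] := polar_decomposition A.
rewrite -mxtraceZ; apply: trnorm_sqrt; first exact: psdZ.
rewrite [adjmx _]linearZ /= -!scalemxAl -!scalemxAr !scalerA -expr2 normCKC.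
by rewrite -{1}UP -(psd_mulmx_adj _ pP) -mulmxA UA.
Qed.

Lemma trnorm_ge0 n (A : 'M[C]_n) : 0 <= trnorm A.
Proof.
by have [U [P [_ pP _ _ ->]]] := polar_decomposition A; exact: mxtrace_psd_ge0.
Qed.

Lemma trnorm_eq0 n (A : 'M[C]_n) : trnorm A = 0 -> A = 0.
Proof.
have [U [P [_ pP <- _ ->]]] := polar_decomposition A => trP.
suff -> : P = 0 by rewrite mulmx0.
by rewrite -[P]mul1mx; apply: mxtrace_psd_congr_eq0; rewrite // adjmx1 mul1mx mulmx1.
Qed.

End TraceNorm.

Section KrausMaps.
Variable C : numClosedFieldType.

Definition kraus_map m p (I : finType) (K : I -> 'M[C]_(p, m)) (X : 'M[C]_m) :
    'M[C]_p :=
  \sum_a K a *m X *m adjmx (K a).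

Variables (m p : nat) (I : finType) (K : I -> 'M[C]_(p, m)).

Lemma kraus_map_is_linear : linear (kraus_map K).
Proof.
move=> c X Y; rewrite /kraus_map scaler_sumr -big_split; apply: eq_bigr => a _.
by rewrite /= mulmxDr mulmxDl -scalemxAr -scalemxAl.
Qed.

HB.instance Definition _ :=
  GRing.isLinear.Build C _ _ _ (kraus_map K) kraus_map_is_linear.

Lemma kraus_map_psd X : psd X -> psd (kraus_map K X).
Proof.
move=> pX; apply: (big_ind (@psd C p)) => [|A B|a _].
- exact: psd0.
- exact: psdD.
- exact: psd_congr.
Qed.

Lemma kraus_map_adj X : kraus_map K (adjmx X) = adjmx (kraus_map K X).
Proof.
rewrite linear_sum; apply: eq_bigr => a _.
by rewrite /= !adjmxM adjmxK mulmxA.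
Qed.

Lemma kraus_map_block A B A' B' :
  block_mx (kraus_map K A) (kraus_map K B) (kraus_map K A') (kraus_map K B')
    = kraus_map (fun a => block_mx (K a) 0 0 (K a)) (block_mx A B A' B').
Proof.
have diag_congr a : block_mx (K a) 0 0 (K a) *m block_mx A B A' B'
      *m adjmx (block_mx (K a) 0 0 (K a))
    = block_mx (K a *m A *m adjmx (K a)) (K a *m B *m adjmx (K a))
               (K a *m A' *m adjmx (K a)) (K a *m B' *m adjmx (K a)).
  by rewrite adjmx_block linear0 !mulmx_block !mul0mx !mulmx0 !addr0 !add0r.
by rewrite /kraus_map sum_block_mx; apply: eq_bigr => a _; rewrite diag_congr.
Qed.

End KrausMaps.

Lemma kraus_map_trnorm_le (C : numClosedFieldType) m p (I : finType)
    (K : I -> 'M[C]_(p, m)) (W : 'M[C]_m) :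
  (forall X, \tr (kraus_map K X) = \tr X) -> trnorm (kraus_map K W) <= trnorm W.
Proof.
move=> trK; have [P1 [P2 [pB trP1 trP2]]] := exists_block_psd_trnorm W.
rewrite -(@ler_pMn2r _ 2) // [leRHS]mulr2n -{1}trP1 -trP2 -(trK P1) -(trK P2).
apply: block_psd_trnorm_le; rewrite -kraus_map_adj kraus_map_block.
exact: kraus_map_psd.
Qed.

Section Amplification.
Variable C : numClosedFieldType.

Lemma idx_pairK n m (i : 'I_n) (k : 'I_m) : idx_pair (mxvec_index i k) = (i, k).
Proof. by rewrite /idx_pair cast_ordK enum_rankK. Qed.

Lemma sum_mxvec_index (V : nmodType) n m (F : 'I_(n * m) -> V) :
  \sum_p F p = \sum_i \sum_k F (mxvec_index i k).
Proof.
rewrite pair_bigA (reindex _ (curry_mxvec_bij n m)) /=.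
by apply: eq_bigr => -[i k].
Qed.

Lemma blockmxP n m (X Y : 'M[C]_(n * m)) :
  (forall i j, blockmx X i j = blockmx Y i j) <-> X = Y.
Proof.
split=> [XY|->//]; apply/matrixP; case/mxvec_indexP=> i k; case/mxvec_indexP=> j l.
by move/matrixP/(_ k l): (XY i j); rewrite !mxE.
Qed.

Lemma blockmx_adj n m (X : 'M[C]_(n * m)) i j :
  blockmx (adjmx X) i j = adjmx (blockmx X j i).
Proof. by apply/matrixP=> k l; rewrite !mxE. Qed.

Lemma blockmxM n m (X Y : 'M[C]_(n * m)) i j :
  blockmx (X *m Y) i j = \sum_k blockmx X i k *m blockmx Y k j.
Proof.
apply/matrixP=> a b; rewrite !mxE sum_mxvec_index summxE; apply: eq_bigr => k _.
by rewrite mxE; apply: eq_bigr => e _; rewrite !mxE.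
Qed.

Lemma mxtrace_blockmx n m (X : 'M[C]_(n * m)) : \tr X = \sum_i \tr (blockmx X i i).
Proof.
rewrite /mxtrace sum_mxvec_index; apply: eq_bigr => i _; apply: eq_bigr => k _.
by rewrite mxE.
Qed.

Lemma blockmx_ampl n m (f : 'M[C]_m -> 'M[C]_m) (X : 'M[C]_(n * m)) i j :
  blockmx (ampl f X) i j = f (blockmx X i j).
Proof. by apply/matrixP=> k l; rewrite !mxE !idx_pairK. Qed.

Lemma eq_ampl n m (f g : 'M[C]_m -> 'M[C]_m) :
  f =1 g -> @ampl C n m f =1 ampl g.
Proof. by move=> fg X; apply/blockmxP => i j; rewrite !blockmx_ampl. Qed.

Lemma ampl_comp n m (f g : 'M[C]_m -> 'M[C]_m) :
  @ampl C n m (f \o g) =1 ampl f \o ampl g.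
Proof. by move=> X; apply/blockmxP => i j; rewrite !blockmx_ampl. Qed.

Lemma ampl_cancel n m (f g : 'M[C]_m -> 'M[C]_m) :
  cancel f g -> cancel (@ampl C n m f) (ampl g).
Proof. by move=> fK X; apply/blockmxP => i j; rewrite !blockmx_ampl fK. Qed.

Lemma ampl_adj n m (f : 'M[C]_m -> 'M[C]_m) (X : 'M[C]_(n * m)) :
  {morph f : Y / adjmx Y} -> ampl f (adjmx X) = adjmx (ampl f X).
Proof.
by move=> fA; apply/blockmxP => i j; rewrite blockmx_adj !blockmx_ampl blockmx_adj.
Qed.

Lemma amplZ n m (f : 'M[C]_m -> 'M[C]_m) c (X : 'M[C]_(n * m)) :
  scalable f -> ampl f (c *: X) = c *: ampl f X.
Proof.
have blockZ (Y : 'M[C]_(n * m)) i j : blockmx (c *: Y) i j = c *: blockmx Y i j.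
  by apply/matrixP=> k l; rewrite !mxE.
by move=> fZ; apply/blockmxP => i j; rewrite blockZ !blockmx_ampl blockZ fZ.
Qed.

Lemma mxtrace_ampl n m (f : 'M[C]_m -> 'M[C]_m) (X : 'M[C]_(n * m)) :
  trace_preserving f -> \tr (ampl f X) = \tr X.
Proof.
move=> trf; rewrite !mxtrace_blockmx; apply: eq_bigr => i _.
by rewrite blockmx_ampl trf.
Qed.

(* 1_n (x) K *)
Definition ampl_mx n m (K : 'M[C]_m) : 'M[C]_(n * m) := ampl (mulmx K) 1%:M.

Lemma blockmx_ampl_mxM n m (K : 'M[C]_m) (X : 'M[C]_(n * m)) i j :
  blockmx (ampl_mx n K *m X) i j = K *m blockmx X i j.
Proof.
rewrite blockmxM; under eq_bigr do rewrite blockmx_ampl -mulmxA.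
by rewrite -mulmx_sumr -blockmxM mul1mx.
Qed.

Lemma ampl_mx_congr n m (K : 'M[C]_m) (X : 'M[C]_(n * m)) :
  ampl_mx n K *m X *m adjmx (ampl_mx n K) = ampl (fun Y => K *m Y *m adjmx K) X.
Proof.
apply/blockmxP => i j; rewrite blockmx_ampl -[LHS]adjmxK -blockmx_adj adjmxM adjmxK.
by rewrite blockmx_ampl_mxM blockmx_adj blockmx_ampl_mxM adjmxM adjmxK.
Qed.

Lemma ampl_kraus_map n m (I : finType) (K : I -> 'M[C]_m) :
  @ampl C n m (kraus_map K) =1 kraus_map (fun a => ampl_mx n (K a)).
Proof.
move=> X; rewrite /kraus_map; under [RHS]eq_bigr do rewrite ampl_mx_congr.
by apply/matrixP=> p q; rewrite mxE !summxE; apply: eq_bigr => a _; rewrite [RHS]mxE.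
Qed.

(* The unnormalised projector onto the vector \sum_i e_i (x) e_i. *)
Definition max_entangled d : 'M[C]_(d * d) :=
  adjmx (mxvec 1%:M) *m mxvec 1%:M.

Lemma psd_max_entangled d : psd (max_entangled d).
Proof. by have := psd_gram (adjmx (mxvec (1%:M : 'M[C]_d))); rewrite adjmxK. Qed.

Lemma blockmx_max_entangled d i j : blockmx (max_entangled d) i j = delta_mx i j.
Proof.
apply/matrixP=> k l; rewrite !mxE big_ord1 !mxE !mxvecE !mxE conjC_nat -natrM mulnb.
by rewrite (eq_sym k) (eq_sym l).
Qed.

End Amplification.

Section CompletelyPositiveMaps.
Variables (C : numClosedFieldType) (d : nat).
Implicit Type f : {linear 'M[C]_d -> 'M[C]_d}.

Lemma kraus_map_completely_positive (I : finType) (K : I -> 'M[C]_d) :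
  completely_positive (kraus_map K).
Proof. by move=> n X pX; rewrite ampl_kraus_map; exact: kraus_map_psd. Qed.

Lemma choi_psd_kraus f : psd (ampl f (max_entangled C d)) ->
  exists K : 'I_(d * d) -> 'M[C]_d, f =1 kraus_map K.
Proof.
case/psd_sqrt => S pS choiE.
exists (fun a => \matrix_(k, i) S (mxvec_index i k) a).
apply: eq_linear_delta => i j; rewrite -blockmx_max_entangled -blockmx_ampl choiE.
apply/matrixP=> k l; rewrite blockmx_max_entangled -{2}(psd_hermitian pS) !mxE summxE.
apply: eq_bigr => a _; rewrite -(mul_delta_mx (0 : 'I_1)) mulmxA -colE -mulmxA -rowE.
by rewrite !mxE big_ord1 !mxE.
Qed.

Lemma completely_positive_tfae f :
  [<-> completely_positive f;
       psd (ampl f (max_entangled C d));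
       exists K : 'I_(d * d) -> 'M[C]_d, f =1 kraus_map K].
Proof.
tfae=> [|/choi_psd_kraus//|[K fK] n X]; first by apply; exact: psd_max_entangled.
by rewrite (eq_ampl fK); exact: kraus_map_completely_positive.
Qed.

Lemma completely_positive_adj f : completely_positive f -> {morph f : X / adjmx X}.
Proof. by case/(completely_positive_tfae f 0 2) => K fK X; rewrite !fK kraus_map_adj. Qed.

Lemma cptp_trnorm_ampl_le n (f : 'M[C]_d -> 'M[C]_d) (W : 'M[C]_(n * d)) :
  cptp f -> trnorm (ampl f W) <= trnorm W.
Proof.
case=> /exists_linear[g ->] [/(completely_positive_tfae g 0 2)[K gK] trg].
rewrite (eq_ampl gK) ampl_kraus_map; apply: kraus_map_trnorm_le => X.
by rewrite -ampl_kraus_map -(eq_ampl gK) mxtrace_ampl.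
Qed.

Lemma completely_positive_of_trnorm_le f : trace_preserving f ->
  trnorm (ampl f (max_entangled C d)) <= trnorm (max_entangled C d) ->
  completely_positive f.
Proof.
move=> trf; rewrite [leRHS]trnorm_psd; last exact: psd_max_entangled.
rewrite -(mxtrace_ampl _ trf) => /psd_of_trnorm_le_tr.
exact: (completely_positive_tfae f 1 0).1.
Qed.

Lemma diamond_norm_trnorm_le f (r : C) (W : 'M[C]_(d * d)) :
  diamond_norm_is f r -> trnorm (ampl f W) <= r * trnorm W.
Proof.
have fZ : scalable f by move=> c X; rewrite linearZ.
case=> le_r _; have [W0|W_neq0] := eqVneq (trnorm W) 0.
  by rewrite (trnorm_eq0 W0) -(scale0r 0) amplZ // !trnormZ normr0 !mul0r mulr0.
have := le_r ((trnorm W)^-1 *: W).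
rewrite amplZ // !trnormZ ger0_norm ?invr_ge0 ?trnorm_ge0 // mulVf // => /(_ erefl).
by rewrite ler_pdivrMl 1?mulrC // lt_def W_neq0 trnorm_ge0.
Qed.

Lemma cptp_diamond_norm (f : 'M[C]_d -> 'M[C]_d) :
  (0 < d)%N -> cptp f -> diamond_norm_is f 1.
Proof.
move=> d_gt0 cptpf; split=> [W <-|r' le_r']; first exact: cptp_trnorm_ampl_le.
have [_ [cpf trf]] := cptpf.
pose W : 'M[C]_(d * d) := (d * d)%:R^-1 *: 1%:M.
have pW : psd W by apply: psdZ; [rewrite invr_ge0 ler0n | exact: psd1].
have trW : \tr W = 1.
  by rewrite mxtraceZ mxtrace1 mulVf // pnatr_eq0 muln_eq0 orbb -lt0n.
have := le_r' W; rewrite !trnorm_psd ?mxtrace_ampl ?trW //; first exact.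
exact: cpf.
Qed.

Lemma completely_positive_diamondP f : (0 < d)%N -> trace_preserving f ->
  completely_positive f <-> diamond_norm_is f 1.
Proof.
move=> d_gt0 trf; split=> [cpf|/diamond_norm_trnorm_le le1].
  by apply: cptp_diamond_norm => //; split; first exact: linearP.
by apply: completely_positive_of_trnorm_le; rewrite // -[leRHS]mul1r.
Qed.

Section Propagator.
Variables f finv g : {linear 'M[C]_d -> 'M[C]_d}.
Hypotheses (fK : cancel f finv) (finvK : cancel finv f).
Hypotheses (trf : trace_preserving f) (trg : trace_preserving g).

Lemma trace_preserving_comp_inv : trace_preserving (g \o finv).
Proof. by move=> X; rewrite /= trg -trf finvK. Qed.

Lemma completely_positive_comp_invP : {morph f : X / adjmx X} ->
  completely_positive (g \o finv) <->
  forall W : 'M[C]_(d * d), is_hermitian W -> trnorm (ampl g W) <= trnorm (ampl f W).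
Proof.
move=> f_adj; split=> [cpV W _|le_gf].
  rewrite -[W in ampl g W](ampl_cancel fK) -[ampl g _]ampl_comp.
  apply: cptp_trnorm_ampl_le; split; first exact: linearP.
  by split=> //; exact: trace_preserving_comp_inv.
have finv_adj : {morph finv : X / adjmx X}.
  by move=> X; apply: (can_inj fK); rewrite f_adj !finvK.
apply: completely_positive_of_trnorm_le; first exact: trace_preserving_comp_inv.
rewrite ampl_comp /= -[leRHS](congr1 _ (ampl_cancel finvK _)).
apply: le_gf; rewrite /is_hermitian -ampl_adj //.
by rewrite psd_hermitian //; exact: psd_max_entangled.
Qed.

End Propagator.

Lemma propagator_completely_positiveP (f finv g : 'M[C]_d -> 'M[C]_d) :
    (0 < d)%N -> cptp f -> cptp g -> cancel f finv -> cancel finv f ->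
  (completely_positive (g \o finv) <-> diamond_norm_is (g \o finv) 1) /\
  (completely_positive (g \o finv) <->
   forall W : 'M[C]_(d * d), is_hermitian W -> trnorm (ampl g W) <= trnorm (ampl f W)).
Proof.
move=> d_gt0 [/exists_linear[f' ->] [cpf trf]] [/exists_linear[g' ->] [_ trg]] fK finvK.
have [finv' finvE] := exists_linear (can2_linear fK finvK); subst finv.
have f_adj := completely_positive_adj cpf.
split; last exact: completely_positive_comp_invP.
exact/completely_positive_diamondP/(trace_preserving_comp_inv finvK).
Qed.

End CompletelyPositiveMaps.

Theorem theorem3 (C : numClosedFieldType) (d : nat) (hd : (0 < d)%N)
  (L Linv : R -> 'M[C]_d -> 'M[C]_d)
  (HL : dynamical_map L)
  (Hinv : forall t : R, Rle 0 t -> cancel (L t) (Linv t) /\ cancel (Linv t) (L t)) :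
  let V := fun t s : R => L t \o Linv s in
  ((forall t s : R, Rle 0 s -> Rle s t -> completely_positive (V t s)) <->
   (forall t s : R, Rle 0 s -> Rle s t -> diamond_norm_is (V t s) 1)) /\
  ((forall t s : R, Rle 0 s -> Rle s t -> diamond_norm_is (V t s) 1) <->
   (forall W : 'M[C]_(d * d), is_hermitian W ->
      forall t1 t2 : R, Rle 0 t1 -> Rle t1 t2 ->
        trnorm (ampl (L t2) W) <= trnorm (ampl (L t1) W))).
Proof.
move=> V; have [cptpL _] := HL.
have cpVP t s (s0 : Rle 0 s) (st : Rle s t) :=
  propagator_completely_positiveP hd (cptpL s s0) (cptpL t (Rle_trans _ _ _ s0 st))
    (Hinv s s0).1 (Hinv s s0).2.
have cp_diamond : (forall t s, Rle 0 s -> Rle s t -> completely_positive (V t s)) <->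
    (forall t s, Rle 0 s -> Rle s t -> diamond_norm_is (V t s) 1).
  by split=> allV t s s0 st; apply/(cpVP t s s0 st).1; exact: allV.
split=> //; rewrite -cp_diamond; split=> [cpV W hW s t s0 st|decr t s s0 st].
  exact: (cpVP t s s0 st).2.1 (cpV t s s0 st) W hW.
by apply/(cpVP t s s0 st).2 => W hW; exact: decr.
Qed.
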